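(* Let $n \ge 0$ and let $F = (F_k)_{k \in \mathbb{Z}}$ be a complex sequence supported on $\{0, \ldots, n\}$ (i.e. $F_k = 0$ for $k \notin \{0,\ldots,n\}$). Assume that the Non-Linear Fourier Transform maps $F$ to the pair $(a,b) \in \mathbf{H}$, i.e. $\mathcal{G}_F(z) = (a(z), b(z))$. For each $k \in \{0,\ldots,n\}$ define the processing operator $$A_k := \frac{1}{\sqrt{1 + |F_k|^2}} \begin{bmatrix} 1 & F_k \\ -F_k^* & 1 \end{bmatrix}.$$ Then, with $\tilde{w} = \mathrm{diag}(z,1)$, for all $z \in \mathbb{T}$ the analytic QSP protocol gives $$A_0 \tilde{w} A_1 \tilde{w} \cdots \tilde{w} A_n = \mathcal{G}_F(z) \cdot \tilde{w}^{n} = \begin{bmatrix} z^n a(z) & b(z) \\ - z^n b^*(z) & a^*(z) \end{bmatrix}.$$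
   Context: $\mathbb{T} = \{z \in \mathbb{C} : |z| = 1\}$, $\mathbb{D} = \{z \in \mathbb{C}: |z| \le 1\}$, $\mathbb{D}^* = \{1/\overline{z} : z \in \mathbb{D}\}$. For a complex number $c$, $c^*$ is its complex conjugate; for a function $f$ of a complex variable, $f^*(z) := \overline{f(1/\overline{z})}$ (so $f^*(z) = \overline{f(z)}$ on $\mathbb{T}$). Non-Linear Fourier Transform (NLFT) over $SU(2)$: for a complex sequence $F=(F_k)_{k\in\mathbb{Z}}$, $$\mathcal{G}_F(z) = \prod_{k=-\infty}^{+\infty} \frac{1}{\sqrt{1+|F_k|^2}} \begin{bmatrix} 1 & F_k z^k \\ -F_k^* z^{-k} & 1 \end{bmatrix}, \qquad z \in \mathbb{T},$$ where the factors are ordered from left to right by increasing $k$ (for finitely supported $F$ this is a finite product, since the other factors are the identity). It is a function $\mathbb{T} \to SU(2)$. The pair $(a,b)$ is shorthand for the unique $SU(2)$ element whose first row is $(a,b)$, i.e. $\begin{bmatrix} a & b \\ -b^* & a^*\end{bmatrix}$; thus $\mathcal{G}_F(z) = (a(z),b(z))$. Space $\mathbf{H}$: for $k \in \mathbb{Z}$, $\mathbf{H}_{\ge k}$ is the space of pairs of measurable functions $(a,b)$ on $\mathbb{T}$ such that (1) $aa^* + bb^* = 1$ almost everywhere on $\mathbb{T}$; (2) $a \in H^2(\mathbb{D}^* )$ with $a(\infty) > 0$, and $b \in z^k H^2(\mathbb{D})$; (3) $a^*$ and $b$ share no non-trivial common inner factor, where $f \in H^2(\mathbb{D})$ is inner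 if $|f|=1$ a.e. on $\mathbb{T}$, and $f$ is a common factor if $a^* = f a'$, $b = f b'$ for some $a',b'$. Here $H^2(\mathbb{D})$, $H^2(\mathbb{D}^* )$ are the Hardy spaces (power series with only non-negative, respectively only non-positive, frequencies). $\mathbf{H} = \bigcup_k \mathbf{H}_{\ge k}$. Analytic QSP: a protocol $A_0 \tilde{w} A_1 \tilde{w} \cdots \tilde{w} A_n$ alternating operators $A_k \in SU(2)$ independent of $z$ with the signal operator $\tilde{w} = \mathrm{diag}(z,1)$, $z\in\mathbb{T}$. *)

(* Defs.v *)
From HB Require Import structures.
From mathcomp Require Export all_boot all_order all_algebra.
From mathcomp Require Export complex.
From mathcomp Require Export all_classical all_reals all_analysis.
Export Order.TTheory GRing.Theory Num.Theory.
Export numFieldNormedType.Exports.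

Set Implicit Arguments.
Unset Strict Implicit.
Unset Printing Implicit Defensive.

Global Open Scope classical_set_scope.
Global Open Scope ring_scope.

(* MathComp-Analysis attaches its topology to terms of the form
   [Num.NumField.sort K]; naming [R[i]] as a [numClosedFieldType] makes that
   topology available on complex numbers and on complex matrices. *)
Definition Cx (R : realType) : numClosedFieldType := R[i].

(* Functions on the unit circle are total functions [Cx R -> Cx R] of which only
   the values on the circle are ever used. *)
Definition unit_circle (R : realType) : set (Cx R) := [set z | `|z| = 1].

Definition mx2 (K : Type) (p q r s : K) : 'M[K]_2 :=
  \matrix_(i, j) if i == 0 then (if j == 0 then p else q)
                 else (if j == 0 then r else s).

Definition star (R : realType) (f : Cx R -> Cx R) : Cx R -> Cx R :=
  fun z => Num.conj (f (Num.conj z)^-1).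

Definition su2_pair (R : realType) (a b : Cx R -> Cx R) (z : Cx R) : 'M[Cx R]_2 :=
  mx2 (a z) (b z) (- star b z) (star a z).

Definition nlft_factor (R : realType) (F : int -> Cx R) (z : Cx R) (k : int) :
    'M[Cx R]_2 :=
  (sqrtC (1 + `|F k| ^+ 2))^-1 *:
    mx2 1 (F k * z ^ k) (- (Num.conj (F k) * z ^ (- k))) 1.

(* The factors of index -M, ..., N, from left to right. *)
Definition nlft_window (R : realType) (F : int -> Cx R) (z : Cx R) (M N : nat) :
    'M[Cx R]_2 :=
  \prod_(0 <= i < (M + N).+1) nlft_factor F z (i%:Z - M%:Z).

(* The two ends of the bi-infinite product tend to infinity independently. *)
Definition nlft (R : realType) (F : int -> Cx R) (z : Cx R) : 'M[Cx R]_2 :=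
  lim (nlft_window F z MN.1 MN.2 @[MN --> filter_prod \oo \oo]).

Definition circle_pt (R : realType) (t : R) : Cx R := (cos t +i* sin t)%C.

Definition angles (R : realType) : set R := `[0, 2 * pi]%classic.

Definition ae_circle (R : realType) (P : Cx R -> Prop) : Prop :=
  {ae (@lebesgue_measure R), forall t, angles t -> P (circle_pt t)}.

Definition measurable_circle (R : realType) (f : Cx R -> Cx R) : Prop :=
  measurable_fun (@angles R) (fun t : R => complex.Re (f (circle_pt t))) /\
  measurable_fun (@angles R) (fun t : R => complex.Im (f (circle_pt t))).

Definition L2_circle (R : realType) (f : Cx R -> Cx R) : Prop :=
  measurable_circle f /\
  (@lebesgue_measure R).-integrable (@angles R)
    (fun t : R => (complex.Re `|f (circle_pt t)| ^+ 2)%:E).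

(* The coefficient of z^k: the mean of f(z) z^(-k) over the circle. *)
Definition fourier_coef (R : realType) (f : Cx R -> Cx R) (k : int) : Cx R :=
  let g (t : R) : R[i] := f (circle_pt t) * circle_pt t ^ (- k) in
  let mean (h : R -> R) : R :=
    (2 * pi)^-1 * \int[@lebesgue_measure R]_(t in @angles R) h t in
  (mean (fun t => complex.Re (g t)) +i* mean (fun t => complex.Im (g t)))%C.

Definition hardy_disk (R : realType) (f : Cx R -> Cx R) : Prop :=
  L2_circle f /\ forall k : int, k < 0 -> fourier_coef f k = 0.

Definition hardy_codisk (R : realType) (f : Cx R -> Cx R) : Prop :=
  L2_circle f /\ forall k : int, 0 < k -> fourier_coef f k = 0.

Definition shifted_hardy_disk (R : realType) (k : int) (f : Cx R -> Cx R) : Prop :=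
  measurable_circle f /\
  exists2 g, hardy_disk g & ae_circle (fun z => f z = z ^ k * g z).

(* For f in the Hardy space of the exterior disk, f(oo) is the constant term of
   its expansion in non-positive powers of z. *)
Definition value_at_infty (R : realType) (f : Cx R -> Cx R) : Cx R :=
  fourier_coef f 0.

Definition inner_fun (R : realType) (f : Cx R -> Cx R) : Prop :=
  hardy_disk f /\ ae_circle (fun z => `|f z| = 1).

Definition trivial_inner (R : realType) (f : Cx R -> Cx R) : Prop :=
  exists c : Cx R, ae_circle (fun z => f z = c).

(* The cofactors are required to lie in the Hardy spaces of the functions they
   divide: with arbitrary measurable cofactors every inner f would divide. *)
Definition common_inner_factor (R : realType) (k : int)
    (g h f : Cx R -> Cx R) : Prop :=
  inner_fun f /\
  exists g' h' : Cx R -> Cx R,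
    [/\ hardy_disk g', shifted_hardy_disk k h',
        ae_circle (fun z => g z = f z * g' z) &
        ae_circle (fun z => h z = f z * h' z)].

(* In the complex order, [0 < c] means that c is real and positive. *)
Definition H_ge (R : realType) (k : int) (a b : Cx R -> Cx R) : Prop :=
  [/\ measurable_circle a /\ measurable_circle b,
      ae_circle (fun z => a z * star a z + b z * star b z = 1),
      [/\ hardy_codisk a, 0 < value_at_infty a & shifted_hardy_disk k b] &
      forall f, common_inner_factor k (star a) b f -> trivial_inner f].

Definition H_space (R : realType) (a b : Cx R -> Cx R) : Prop :=
  exists k : int, H_ge k a b.

Definition signal_op (R : realType) (z : Cx R) : 'M[Cx R]_2 := mx2 z 0 0 1.

Definition processing_op (R : realType) (F : int -> Cx R) (k : nat) : 'M[Cx R]_2 :=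
  (sqrtC (1 + `|F k%:Z| ^+ 2))^-1 *:
    mx2 1 (F k%:Z) (- Num.conj (F k%:Z)) 1.

(* A_0 w A_1 w ... w A_n *)
Definition qsp_protocol (R : realType) (A : nat -> 'M[Cx R]_2) (n : nat)
    (w : 'M[Cx R]_2) : 'M[Cx R]_2 :=
  A 0%N * \prod_(1 <= k < n.+1) (w * A k).

(* Main.v *)
(** With w = diag(z, 1), the k-th factor of the transform is the conjugate
    w^k A_k w^-k of the processing operator, so the product of the factors
    0, ..., n telescopes to A_0 w A_1 w ... w A_n w^-n.  The bi-infinite product
    is a limit of windows that are all equal to this finite product as soon as
    they reach n on the right. *)
Require Import Defs.

Set Implicit Arguments.
Unset Strict Implicit.
Unset Printing Implicit Defensive.

Lemma mx2_mul (K : pzRingType) (p q r s p' q' r' s' : K) :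
  mx2 p q r s * mx2 p' q' r' s' =
  mx2 (p * p' + q * r') (p * q' + q * s') (r * p' + s * r') (r * q' + s * s').
Proof.
apply/matrixP => i j; rewrite !mxE !big_ord_recl big_ord0 !mxE addr0 /=.
by case: ifP => _; case: ifP.
Qed.

Lemma mx2_1 (K : pzRingType) : mx2 (1 : K) 0 0 1 = 1.
Proof.
by apply/matrixP => -[[|[|//]] i] [[|[|//]] j]; rewrite !mxE.
Qed.

Lemma signal_opX (R : realType) (z : Cx R) (n : nat) :
  signal_op z ^+ n = mx2 (z ^+ n) 0 0 1.
Proof.
elim: n => [|n IHn]; first by rewrite !expr0 mx2_1.
by rewrite exprS IHn mx2_mul !mulr0 !mul0r !mulr1 !addr0 !add0r -exprS.
Qed.

(** The conjugation is stated without inverting [signal_op z]. Only the lower-left entry needs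
    [z != 0], to cancel [z ^ (- k)] against [z ^ k]. *)
Lemma nlft_factor_signal_op (R : realType) (F : int -> Cx R) (z : Cx R) (k : nat) :
  z != 0 ->
  nlft_factor F z k%:Z * signal_op z ^+ k = signal_op z ^+ k * processing_op F k.
Proof.
move=> z0; rewrite signal_opX /nlft_factor /processing_op.
rewrite -scalerAl -scalerAr !mx2_mul; congr (_ *: _).
rewrite !mulr0 !mul0r !mulr1 !mul1r !addr0 !add0r -invr_expz mulNr.
by rewrite -mulrA mulVf ?expf_neq0// mulr1 mulrC.
Qed.

Lemma qsp_protocolE (R : realType) (F : int -> Cx R) (z : Cx R) (n : nat) :
  z != 0 ->
  (\prod_(0 <= k < n.+1) nlft_factor F z k%:Z) * signal_op z ^+ n =
  qsp_protocol (processing_op F) n (signal_op z).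
Proof.
move=> z0; rewrite /qsp_protocol; elim: n => [|n IHn].
  rewrite big_nat1 nlft_factor_signal_op// big_geq// mulr1.
  by rewrite expr0 mul1r.
(* The last factor moves past [w ^+ n.+1 = w ^+ n * w]: [w ^+ n] goes to the induction hypothesis,
   and [w * A n.+1] is the new last factor of the protocol. *)
rewrite big_nat_recr//= -mulrA nlft_factor_signal_op// exprSr.
by rewrite -mulrA mulrA IHn -mulrA -big_nat_recr.
Qed.

Lemma nlft_factor0 (R : realType) (F : int -> Cx R) (z : Cx R) (k : int) :
  F k = 0 -> nlft_factor F z k = 1.
Proof.
move=> Fk; rewrite /nlft_factor Fk normr0 expr0n addr0 sqrtC1 invr1 scale1r.
by rewrite conjC0 !mul0r oppr0 mx2_1.
Qed.

Lemma nlft_window_supp (R : realType) (n : nat) (F : int -> Cx R)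
    (F_supp : forall k : int, ~~ (0 <= k <= n%:Z) -> F k = 0)
    (z : Cx R) (M N : nat) :
  (n <= N)%N ->
  nlft_window F z M N = \prod_(0 <= k < n.+1) nlft_factor F z k%:Z.
Proof.
move=> nN; rewrite /nlft_window.
(* Index [i] carries frequency [i - M], so the indices below [M] have negative frequency and
   contribute identities. *)
rewrite (@big_cat_nat _ _ _ M)//=; last by rewrite -addnS leq_addr.
rewrite big_nat big1 ?mul1r; last first.
  move=> i /andP[_ iM]; apply: nlft_factor0; apply: F_supp.
  by rewrite subr_ge0 lez_nat leqNgt iM.
(* Shifting by [M] makes index and frequency agree on [0, ..., N]; the factors beyond [n] are again
   identities. *)
rewrite -{1}[M]add0n -addnS big_addn addKn.
rewrite (@big_cat_nat _ _ _ n.+1)//= [X in _ * X]big_nat [X in _ * X]big1 ?mulr1.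
  by apply: eq_bigr => i _; rewrite PoszD addrK.
move=> i /andP[ni _]; apply: nlft_factor0; apply: F_supp.
by rewrite PoszD addrK !lez_nat -ltnNge ni.
Qed.

Lemma nlft_supp (R : realType) (n : nat) (F : int -> Cx R)
    (F_supp : forall k : int, ~~ (0 <= k <= n%:Z) -> F k = 0)
    (z : Cx R) :
  nlft F z = \prod_(0 <= k < n.+1) nlft_factor F z k%:Z.
Proof.
apply: cvg_lim; first exact: norm_hausdorff.
(* The left end [M] is unconstrained: every window already contains frequency [0]. *)
apply: cvg_near_cst; exists (setT, [set N | (n <= N)%N]).
  by split; [exact: filterT | exact: nbhs_infty_ge].
by move=> [M N] [_ /= nN]; exact: nlft_window_supp.
Qed.

Theorem lemma7 (R : realType) (n : nat) (F : int -> Cx R) (a b : Cx R -> Cx R)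
  (F_supp : forall k : int, ~~ (0 <= k <= n%:Z) -> F k = 0)
  (ab_H : H_space a b)
  (F_nlft : forall z : Cx R, unit_circle z -> nlft F z = su2_pair a b z) :
  forall z : Cx R, unit_circle z ->
    qsp_protocol (processing_op F) n (signal_op z) = nlft F z * signal_op z ^+ n /\
    nlft F z * signal_op z ^+ n =
      mx2 (z ^+ n * a z) (b z) (- (z ^+ n * star b z)) (star a z).
Proof.
move=> z zT; have z0 : z != 0 by rewrite -normr_eq0 zT oner_eq0.
split; first by rewrite (nlft_supp F_supp) qsp_protocolE.
(* Right multiplication by [diag(z ^+ n, 1)] scales only the first column. *)
rewrite F_nlft// signal_opX mx2_mul !mulr0 !mulr1 !addr0 !add0r.
by rewrite mulNr ![_ * z ^+ n]mulrC.
Qed.
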